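(* If $f,g\in L^{\infty}_1(\ell_2)$, then $(fg,\tfrac12,1)$ is a Bessel system, i.e. there is a constant $B<\infty$ such that $$\sum_{m,n\in\mathbb Z}\left|\langle h,E_{m}T_{n/2}(fg)\rangle\right|^2\le B\,\|h\|^2_{L^2(\mathbb R)}\quad\text{for all } h\in L^2(\mathbb R).$$
   Context: $L^{\infty}_1(\ell_2)$ is the set of measurable functions $f:\mathbb R\to\mathbb C$ (identified when equal a.e.) with $\|f\|^2_{L^{\infty}_1(\ell_2)}=\operatorname*{ess\,sup}_{x\in[0,1]}\sum_{k\in\mathbb Z}|f(x-k)|^2<\infty$. For $a,b\in\mathbb R$, $T_af(x)=f(x-a)$ and $E_bf(x)=e^{2\pi i b x}f(x)$. For $g\in L^2(\mathbb R)$, $(g,a,b)$ denotes the Gabor system $\{E_{mb}T_{na}g\}_{m,n\in\mathbb Z}$. *)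

(* Defs.v *)
From HB Require Import structures.
From mathcomp Require Import all_boot all_order all_algebra.
From mathcomp Require Import complex.
From mathcomp Require Import all_classical all_reals all_analysis.
From mathcomp Require Import ess_sup_inf.

Set Implicit Arguments.
Unset Strict Implicit.
Unset Printing Implicit Defensive.

Import Order.TTheory GRing.Theory Num.Theory.

Local Open Scope classical_set_scope.
Local Open Scope ring_scope.
Local Open Scope complex_scope.

(* MathComp-Analysis puts no sigma-algebra on [R[i]] and integrates only real
   and extended-real functions, so measurability and the integral of a
   complex-valued function are taken on its real and imaginary parts. A function
   stands for its class modulo a.e. equality: measurability is the library's
   Borel measurability, and every class of Lebesgue measurable functions has a
   Borel measurable representative. *)
Definition cmeasurable (R : realType) (f : R -> R[i]) : Prop :=
  measurable_fun [set: R] (fun x => complex.Re (f x)) /\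
  measurable_fun [set: R] (fun x => complex.Im (f x)).

(* [\int] here is the real-valued [Rintegral], meaningful on integrable
   functions. *)
Definition cintegral (R : realType) (f : R -> R[i]) : R[i] :=
  (\int[@lebesgue_measure R]_x complex.Re (f x)) +i*
  (\int[@lebesgue_measure R]_x complex.Im (f x)).

(* [Normc.normc : R[i] -> R] is the modulus with values in [R]; the generic norm
   [`|z|] on [R[i]] takes its values in [R[i]]. *)
Definition L2_sqnorm (R : realType) (f : R -> R[i]) : \bar R :=
  (\int[@lebesgue_measure R]_x (Normc.normc (f x) ^+ 2)%:E)%E.

Definition L2 (R : realType) (f : R -> R[i]) : Prop :=
  cmeasurable f /\ (L2_sqnorm f < +oo)%E.

Definition L2_inner (R : realType) (h k : R -> R[i]) : R[i] :=
  cintegral (fun x => h x * conjc (k x)).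

(* The essential supremum over [0,1] is the one for the restriction
   [A |-> lebesgue_measure (A `&` `[0, 1])]. *)
Definition Linf1l2_sqnorm (R : realType) (f : R -> R[i]) : \bar R :=
  ess_sup (mrestr (@lebesgue_measure R) (measurable_itv `[0 : R, 1 : R]))
    (fun x => \esum_(k in [set: int]) (Normc.normc (f (x - k%:~R)) ^+ 2)%:E).

Definition Linf1l2 (R : realType) (f : R -> R[i]) : Prop :=
  cmeasurable f /\ (Linf1l2_sqnorm f < +oo)%E.

Definition translation (R : realType) (a : R) (f : R -> R[i]) : R -> R[i] :=
  fun x => f (x - a).

Definition modulation (R : realType) (b : R) (f : R -> R[i]) : R -> R[i] :=
  fun x => (cos (2 * pi * b * x) +i* sin (2 * pi * b * x)) * f x.

Definition gabor_system (R : realType) (g : R -> R[i]) (a b : R)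
    (mn : int * int) : R -> R[i] :=
  modulation (mn.1%:~R * b) (translation (mn.2%:~R * a) g).

(* A Bessel system is a family of elements of L^2, as in the convention that
   (g, a, b) is only formed for a window g in L^2; this also ensures that the
   integrals defining the inner products converge. *)
Definition bessel_system (R : realType) (I : choiceType)
    (e : I -> R -> R[i]) : Prop :=
  (forall i, L2 (e i)) /\
  exists B : R, forall h : R -> R[i], L2 h ->
    (\esum_(i in [set: I]) (Normc.normc (L2_inner h (e i)) ^+ 2)%:E
      <= B%:E * L2_sqnorm h)%E.

(* Main.v *)
(* Put u = f g. By AM-GM the periodization sum_k |u(x - k)| is bounded almost
   everywhere by some B. For each n, Bessel's inequality for the exponentials on
   the unit interval, applied after periodizing, gives
     sum_m |<h, E_m T_{n/2} u>|^2 <= B int |h|^2 |T_{n/2} u|.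
   Splitting n by parity, sum_n |T_{n/2} u| is the sum of two translates of the
   periodization, hence at most 2 B, so 2 B^2 is a Bessel bound. *)
From HB Require Import structures.
Require Import Defs.
From mathcomp Require Import all_boot all_order all_algebra.
From mathcomp Require Import complex zify ring lra.
From mathcomp Require Import all_classical all_reals all_analysis.
From mathcomp Require Import ess_sup_inf measurable_realfun.

Set Implicit Arguments.
Unset Strict Implicit.
Unset Printing Implicit Defensive.

Import Order.TTheory GRing.Theory Num.Theory.
Import numFieldNormedType.Exports.

Local Open Scope classical_set_scope.
Local Open Scope ring_scope.

(** * Countable sums and translation invariance of Lebesgue measure *)

(** Enumerating [I] by [pickle] turns an unordered sum into a series, to which monotone convergence
    applies; naturals that code no element contribute the default 0. *)
Lemma esum_nneseries (R : realType) (I : countType) (a : I -> \bar R) :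
  (forall i, 0 <= a i)%E ->
  (\esum_(i in [set: I]) a i =
   \sum_(n <oo) oapp a 0 (pickle_inv n))%E.
Proof.
move=> a0; rewrite nneseries_esumT => [|n]; last by case: pickle_inv => /=.
transitivity (\esum_(n in range (@pickle I)) oapp a 0%E (pickle_inv n)).
  rewrite esum_image; last by move=> x y _ _; exact: (pcan_inj pickleK_inv).
  by apply: eq_esum => i _; rewrite pickleK_inv.
rewrite esum_mkcond; apply: eq_esum => n _; case: ifPn => //.
case En: pickle_inv => [i|]//= /negP[]; rewrite inE; exists i => //.
by have := @pickle_invK I n; rewrite /ocancel En.
Qed.

(** By uniqueness of Lebesgue measure, it suffices to compare lengths of half-open intervals, whose
    preimages are the intervals shifted by [a]. *)
Lemma lebesgue_measure_translation (R : realType) (a : R) (A : set R) :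
  measurable A ->
  pushforward (@lebesgue_measure R)
    ((fun x => x - a) : R -> measurableTypeR R) A
  = lebesgue_measure A.
Proof.
have mD : measurable_fun setT
    ((fun x => x - a) : measurableTypeR R -> measurableTypeR R).
  exact: measurable_funB.
pose phi : {mfun measurableTypeR R >-> measurableTypeR R} := HB.pack
  ((fun x => x - a) : measurableTypeR R -> measurableTypeR R)
  (isMeasurableFun.Build _ _ _ _ _ mD).
move=> mA; apply/esym.
apply: (@lebesgue_measure_unique R
  (pushforward (@lebesgue_measure R) phi)) => //=.
move=> _ [[u v]] _ <-.
rewrite /pushforward/= (_ : _ @^-1` _ = `](u + a), (v + a)]%classic).
  rewrite !lebesgue_measure_itv/= !lte_fin ltrD2r.
  by case: ifP => // _; rewrite !EFinN -!EFinD; congr EFin; ring.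
by apply/seteqP; split => x /=; rewrite !in_itv/= ltrBrDr lerBlDr.
Qed.

Lemma ge0_integral_translation (R : realType) (a : R) (F : R -> \bar R) :
  measurable_fun [set: R] F -> (forall x, 0 <= F x)%E ->
  (\int[@lebesgue_measure R]_x F (x - a)%R = \int[@lebesgue_measure R]_x F x)%E.
Proof.
move=> mF F0.
have mD : measurable_fun setT
    ((fun x => x - a) : measurableTypeR R -> measurableTypeR R).
  exact: measurable_funB.
have := @ge0_integral_pushforward _ _ _ _ R _ mD (@lebesgue_measure R) setT F
  measurableT mF (fun x _ => F0 x).
rewrite preimage_setT /= => <-.
by apply: eq_measure_integral => A mA _; exact: lebesgue_measure_translation.
Qed.

Lemma ae_translation (R : realType) (a : R) (P : R -> Prop) :
  {ae @lebesgue_measure R, forall x, P x} ->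
  {ae @lebesgue_measure R, forall x, P (x - a)}.
Proof.
have mD : measurable_fun setT
    ((fun x => x - a) : measurableTypeR R -> measurableTypeR R).
  exact: measurable_funB.
move=> [N [mN N0 PN]]; exists ((fun x => x - a) @^-1` N); split => //.
- by rewrite -[X in measurable X]setTI; exact: mD.
- by rewrite -N0 -(lebesgue_measure_translation a mN).
- by move=> x /= Px; exact: (PN (x - a)).
Qed.

Lemma measurable_esum d (T : measurableType d) (R : realType) (I : countType)
    (F : I -> T -> \bar R) :
  (forall i, measurable_fun setT (F i)) -> (forall i x, 0 <= F i x)%E ->
  measurable_fun setT (fun x => \esum_(i in [set: I]) F i x)%E.
Proof.
move=> mF F0; under eq_fun do rewrite esum_nneseries//.
apply: ge0_emeasurable_sum => [k x _ _|k _]; case: (pickle_inv k) => //= *.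
Qed.

Lemma ge0_integral_esum d (T : measurableType d) (R : realType)
    (mu : {measure set T -> \bar R}) (I : countType) (F : I -> T -> \bar R) :
  (forall i, measurable_fun setT (F i)) -> (forall i x, 0 <= F i x)%E ->
  (\int[mu]_x (\esum_(i in [set: I]) F i x)
   = \esum_(i in [set: I]) \int[mu]_x F i x)%E.
Proof.
move=> mF F0; rewrite esum_nneseries => [|i]; last exact: integral_ge0.
under eq_integral do rewrite esum_nneseries//.
rewrite integral_nneseries => //.
- apply: eq_eseriesr => k _; case: (pickle_inv k) => //=.
  by rewrite integral0.
- by move=> k; case: (pickle_inv k) => //= *.
- by move=> k x _; case: (pickle_inv k) => //= *.
Qed.

Lemma ge0_esumZl (R : realType) (I : countType) (a : I -> \bar R) (c : R) :
  (forall i, 0 <= a i)%E -> 0 <= c ->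
  (\esum_(i in [set: I]) (c%:E * a i) = c%:E * \esum_(i in [set: I]) a i)%E.
Proof.
move=> a0 c0; rewrite !esum_nneseries//; last first.
  by move=> i; rewrite mule_ge0// lee_fin.
rewrite -nneseriesZl; last by move=> k _; case: (pickle_inv k) => /=.
by apply: eq_eseriesr => k _; case: (pickle_inv k) => //=; rewrite mule0.
Qed.

(** * Sums over the integers and periodization *)

Lemma esum_int_shift (R : realType) (a : int -> \bar R) (j : int) :
  (\esum_(k in [set: int]) a (k + j)%R = \esum_(k in [set: int]) a k)%E.
Proof.
rewrite [RHS](reindex_esum setT setT (fun k => k + j))//.
split=> // [k1 k2 _ _|k _]; first exact: addIr.
by exists (k - j) => //; rewrite subrK.
Qed.

Lemma esum_int_opp (R : realType) (a : int -> \bar R) :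
  (\esum_(k in [set: int]) a (- k)%R = \esum_(k in [set: int]) a k)%E.
Proof.
rewrite [RHS](reindex_esum setT setT (fun k => - k))//.
Qed.

Lemma esum_int_parity (R : realType) (a : int -> \bar R) :
  (forall n, 0 <= a n)%E ->
  (\esum_(n in [set: int]) a n =
   \esum_(k in [set: int]) a (k * 2)%R +
   \esum_(k in [set: int]) a (k * 2 + 1)%R)%E.
Proof.
move=> a0; rewrite (esumID (range (fun k : int => k * 2)))// !setTI.
congr (_ + _)%E; first by rewrite esum_image// => k1 k2 _ _ /=; lia.
rewrite [X in esum X](_ : _ = range (fun k : int => k * 2 + 1)).
  by rewrite esum_image// => k1 k2 _ _ /=; lia.
apply/seteqP; split => [n /= nE|_ [k _ <-] [l _ /=]]; last by lia.
have [/eqP n2|n2] := boolP ((n %% 2)%Z == 0).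
  by exfalso; apply: nE; exists (n %/ 2)%Z => //; lia.
by exists (n %/ 2)%Z => //; lia.
Qed.

(** Only k = floor x contributes, since the integer translates of [0, 1[ tile the line; a closed
    interval would count integers twice. *)
Lemma esum_indic_unit (R : realType) (x : R) :
  (\esum_(k in [set: int])
     (\1_(`[0%R, 1%R[%classic : set R) (x - k%:~R))%:E = 1 :> \bar R)%E.
Proof.
have [k0 hk0] : exists k0 : int, k0%:~R <= x < (k0 + 1)%:~R.
  by exists (Num.floor x); rewrite floor_itv ?num_real.
rewrite -[RHS](@esum_set1 _ _ k0 (fun=> 1%E))// [RHS]esum_mkcond.
apply: eq_esum => k _; rewrite indicE.
have -> : (x - k%:~R \in `[0, 1[%classic) = (k \in [set k0]).
  apply/idP/idP; rewrite !inE/= in_itv/= => xk; last by rewrite xk; lra.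
  have : (k < k0 + 1) && (k0 < k + 1) by rewrite -!(ltr_int R) !intrD; lra.
  by lia.
by case: ifP.
Qed.

(** Cut the line into the tiles k + [0, 1[, move each tile back to [0, 1[ by translation invariance,
    and exchange sum and integral by nonnegativity. *)
Lemma ge0_integral_periodization (R : realType) (u p : R -> R) :
  measurable_fun [set: R] u -> measurable_fun [set: R] p ->
  (forall x, 0 <= u x) -> (forall x, 0 <= p x) ->
  (forall x (k : int), p (x - k%:~R) = p x) ->
  (\int[@lebesgue_measure R]_x (u x * p x)%:E =
   \int[@lebesgue_measure R]_(x in `[0%R, 1%R[)
     ((p x)%:E * \esum_(k in [set: int]) (u (x - k%:~R))%:E))%E.
Proof.
move=> mu mp u0 p0 pper.
have mshift (a : R) (v : R -> R) : measurable_fun [set: R] v ->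
    measurable_fun [set: R] (fun x => v (x - a)).
  by move=> mv; apply: (measurableT_comp mv); exact: measurable_funB.
pose F (k : int) (x : R) : R :=
  (\1_(`[0, 1[%classic : set R) x) * (p x * u (x - k%:~R)).
have F0 k x : 0 <= F k x by rewrite /F !mulr_ge0.
have mF k : measurable_fun [set: R] (F k).
  apply: measurable_funM; first exact: measurable_indic.
  by apply: measurable_funM => //; exact: mshift.
(* By periodicity of [p], the k-th summand is u p restricted to the tile k + [0, 1[; the index -k
   undoes the shift in the argument of [u]. *)
transitivity (\int[@lebesgue_measure R]_x
    \esum_(k in [set: int]) (F (- k) (x - k%:~R))%:E)%E.
  apply: eq_integral => x _; rewrite -[LHS]mule1 -(esum_indic_unit x).
  rewrite -ge0_esumZl//; last exact: mulr_ge0.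
  apply: eq_esum => k _; rewrite /F mulrNz opprK subrK pper -EFinM.
  by congr _%:E; ring.
rewrite ge0_integral_esum => [|k|k x]; last 2 first.
- by apply/measurable_EFinP; exact: mshift.
- by rewrite lee_fin.
transitivity (\esum_(k in [set: int])
    \int[@lebesgue_measure R]_x (F (- k) x)%:E)%E.
  apply: eq_esum => k _.
  apply: (@ge0_integral_translation _ k%:~R (fun x => (F (- k) x)%:E)) => [|x].
    exact/measurable_EFinP.
  by rewrite lee_fin.
rewrite (esum_int_opp (fun k => \int[lebesgue_measure]_x (F k x)%:E)%E).
rewrite -(@ge0_integral_esum _ _ _ (@lebesgue_measure R) _
  (fun k x => (F k x)%:E)) => [|k|k x]; first last.
- by rewrite lee_fin.
- by apply/measurable_EFinP; exact: mF.
rewrite [RHS]integral_mkcond.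
apply: eq_integral => x _; rewrite patchE -ge0_esumZl// => [|k];
  last by rewrite lee_fin.
rewrite /F indicE; case: ifPn => _.
  by apply: eq_esum => k _; rewrite mul1r EFinM.
by rewrite esum1// => k _; rewrite mul0r.
Qed.

(** Every x has x - floor x in [0, 1], so the exceptional set is covered by countably many integer
    translates of a null set. *)
Lemma ae_periodic (R : realType) (P : R -> Prop) :
  (forall x (k : int), P (x - k%:~R) -> P x) ->
  {ae mrestr (@lebesgue_measure R) (measurable_itv `[0 : R, 1 : R]),
    forall x, P x} ->
  {ae @lebesgue_measure R, forall x, P x}.
Proof.
move=> Pper [N [mN N0 PN]].
have ae01 : {ae @lebesgue_measure R, forall x, x \in `[0, 1] -> P x}.
  exists (N `&` `[0, 1]%classic); split.
  - by apply: measurableI => //; exact: measurable_itv.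
  - exact: N0.
  - move=> x /= /not_implyP[x01 Px]; split => //; exact: PN.
have aeF := ae_filter_ringOfSetsType (@lebesgue_measure R).
have shift (k : int) :
    {ae @lebesgue_measure R, forall x, (x - k%:~R) \in `[0, 1] -> P x}.
  have := ae_translation k%:~R ae01.
  by apply: filterS => x xP /xP; exact: Pper.
(* The integers are enumerated by their codes; a natural coding no integer harmlessly repeats the
   shift 0. *)
have := ae_foralln (fun n => shift (odflt 0 (pickle_inv n))).
apply: filterS => x xP.
have := xP (pickle (Num.floor x)); rewrite pickleK_inv/=; apply.
have := floor_itv (x : R); rewrite in_itv/= intrD; lra.
Qed.

(** * Almost everywhere bounds on periodizations *)

(** With [u] the modulus of a function, this is the l_1 analogue of the bound in [Linf1l2]. Asking
    for it on the whole line, not just on [0, 1], makes it stable under all real translations. *)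
Definition ae_summable_le (R : realType) (u : R -> R) (B : R) : Prop :=
  {ae @lebesgue_measure R, forall x,
    (\esum_(k in [set: int]) (u (x - k%:~R))%:E <= B%:E)%E}.

(** The essential supremum bounds the sum almost everywhere on [0, 1]; shifting the summation index
    shows that the sum has period 1, so the bound spreads to the line. *)
Lemma Linf1l2_bound (R : realType) (f : R -> R[i]) : Linf1l2 f ->
  exists A : R, 0 <= A /\ ae_summable_le (fun x => Normc.normc (f x) ^+ 2) A.
Proof.
move=> [_ Sfin].
have [A [A0 SA]] : exists A : R, 0 <= A /\ (Linf1l2_sqnorm f <= A%:E)%E.
  (* The essential supremum is an extended real, so the value -oo is also treated; there 0 serves as
     bound. *)
  case: (Linf1l2_sqnorm f) Sfin => [r _| |_]//; last by exists 0; rewrite leNye.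
  by exists `|r|; rewrite lee_fin ler_norm normr_ge0.
exists A; split => //.
have aeF := ae_filter_ringOfSetsType
  (mrestr (@lebesgue_measure R) (measurable_itv `[0 : R, 1 : R])).
apply: ae_periodic => [x j|].
  set S := (X in (X <= _)%E -> _); set T := (X in _ -> (X <= _)%E).
  rewrite (_ : S = T)// /T.
  rewrite -(esum_int_shift _ j); apply: eq_esum => k _.
  by rewrite intrD opprD addrCA addrC.
move: (ess_sup_ge _ _ : {ae _, forall x, (_ <= Linf1l2_sqnorm f)%E}).
apply: filterS => x Sx.
exact: le_trans Sx SA.
Qed.

Lemma Linf1l2_mul_bound (R : realType) (f g : R -> R[i]) :
  Linf1l2 f -> Linf1l2 g ->
  exists2 B : R, 0 < B & ae_summable_le (fun x => Normc.normc (f x * g x)) B.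
Proof.
move=> /Linf1l2_bound[A [A0 fA]] /Linf1l2_bound[C [C0 gC]].
(* The halves come from a c <= (a^2 + c^2) / 2; the added 1 makes the bound strictly positive, as
   [bessel_exponentials] divides by it. *)
exists (2^-1 * A + 2^-1 * C + 1); first lra.
have aeF := ae_filter_ringOfSetsType (@lebesgue_measure R).
apply: filterS2 fA gC => x fA gC.
pose a k := Normc.normc (f (x - k%:~R)).
pose c k := Normc.normc (g (x - k%:~R)).
apply: (@le_trans _ _ (\esum_(k in [set: int])
    (2^-1%:E * (a k ^+ 2)%:E + 2^-1%:E * (c k ^+ 2)%:E))%E).
  apply: le_esum => k _; rewrite -!EFinM -EFinD lee_fin Normc.normcM.
  rewrite -/(a k) -/(c k).
  have := sqr_ge0 (a k - c k); rewrite sqrrB; lra.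
have pos (z : R) : (0 <= 2^-1%:E * (z ^+ 2)%:E)%E.
  by rewrite -EFinM lee_fin; have := sqr_ge0 z; lra.
rewrite esumD// !ge0_esumZl//; [|by move=> k; rewrite lee_fin sqr_ge0..].
apply: (@le_trans _ _ (2^-1 * A + 2^-1 * C)%:E); last by rewrite lee_fin; lra.
by rewrite EFinD !EFinM leeD// lee_wpmul2l// lee_fin.
Qed.

(** Even n = 2k gives the periodization at x and odd n = 2k + 1 gives it at x - 1/2; each is at most
    [B]. *)
Lemma ae_esum_half_shifts (R : realType) (u : R -> R) (B : R) :
  (forall x, 0 <= u x) ->
  ae_summable_le u B ->
  {ae @lebesgue_measure R, forall x,
    (\esum_(n in [set: int]) (u (x - n%:~R * (1 / 2)))%:E <= (B + B)%:E)%E}.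
Proof.
move=> u0 uB.
have aeF := ae_filter_ringOfSetsType (@lebesgue_measure R).
apply: filterS2 uB (ae_translation (1/2) uB) => x xB xhB.
rewrite esum_int_parity => [|n]; last by rewrite lee_fin.
rewrite EFinD leeD//.
  apply: le_trans xB; apply: le_esum => k _; rewrite lee_fin intrM.
  by rewrite (_ : _ * _ = k%:~R)//; field.
apply: le_trans xhB; apply: le_esum => k _; rewrite lee_fin intrD intrM.
by rewrite (_ : x - (_ * _) = x - 1 / 2 - k%:~R)//; field.
Qed.

(** * Integrals of the trigonometric functions over one period *)

Lemma sin_cos_2pi_int (R : realType) (j : int) :
  sin (2 * pi * j%:~R) = 0 :> R /\ cos (2 * pi * j%:~R) = 1 :> R.
Proof.
have natE (n : nat) :
    sin (2 * pi * n%:R) = 0 :> R /\ cos (2 * pi * n%:R) = 1 :> R.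
  rewrite mulr_natr (_ : 2 * pi = pi *+ 2); last by rewrite mulr2n; ring.
  have := periodicn (@sinD2pi R) n 0; have := periodicn (@cosD2pi R) n 0.
  by rewrite !add0r sin0 cos0.
case: j => n; first exact: natE.
rewrite NegzE intrN mulrN sinN cosN -pmulrn.
by rewrite (natE n.+1).1 (natE n.+1).2 oppr0.
Qed.

(** For nonzero j the antiderivative sin(w x) / w, with w = 2 pi j, vanishes at both endpoints; for
    j = 0 the integrand is 1. *)
Lemma Rintegral_cos_2pi_int (R : realType) (j : int) :
  (\int[@lebesgue_measure R]_(x in `[0, 1]) cos (2 * pi * j%:~R * x)
   = (j == 0)%:R :> R).
Proof.
have [->|j0] := eqVneq j 0.
  under eq_Rintegral do rewrite mulr0 mul0r cos0.
  rewrite Rintegral_cst//= lebesgue_measure_itv/= lte_fin ltr01 oppr0 adde0/=.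
  by rewrite mulr1.
set w : R := 2 * pi * j%:~R.
have w0 : w != 0 by rewrite !mulf_neq0 ?pnatr_eq0 ?intr_eq0// lt0r_neq0 ?pi_gt0.
have dF (x : R) : is_derive x 1 (fun x => w^-1 * sin (w * x)) (cos (w * x)).
  apply: is_derive_eq.
  by rewrite /GRing.scale/=; field.
have cF : continuous (fun x => w^-1 * sin (w * x)).
  move=> x; apply: differentiable_continuous; apply/derivable1_diffP.
  by case: (dF x).
rewrite /Rintegral (@continuous_FTC2 _ _ (fun x => w^-1 * sin (w * x)))//.
- by rewrite mulr1 (sin_cos_2pi_int R j).1 !mulr0 sin0 mulr0 /= subrr.
- apply: continuous_subspaceT => x; apply: continuous_comp;
    last exact: continuous_cos.
  exact: mulrl_continuous.
- split.
  + by move=> x _; case: (dF x).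
  + exact/cvg_at_right_filter/cF.
  + exact/cvg_at_left_filter/cF.
- by move=> x _; rewrite derive1E; case: (dF x).
Qed.

Lemma Rintegral_sin_2pi_int (R : realType) (j : int) :
  (\int[@lebesgue_measure R]_(x in `[0, 1]) sin (2 * pi * j%:~R * x) = 0 :> R).
Proof.
have [->|j0] := eqVneq j 0.
  under eq_Rintegral do rewrite mulr0 mul0r sin0.
  by rewrite Rintegral_cst//= mul0r.
set w : R := 2 * pi * j%:~R.
have w0 : w != 0 by rewrite !mulf_neq0 ?pnatr_eq0 ?intr_eq0// lt0r_neq0 ?pi_gt0.
have dF (x : R) : is_derive x 1 (fun x => - w^-1 * cos (w * x)) (sin (w * x)).
  apply: is_derive_eq.
  by rewrite /GRing.scale/=; field.
have cF : continuous (fun x => - w^-1 * cos (w * x)).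
  move=> x; apply: differentiable_continuous; apply/derivable1_diffP.
  by case: (dF x).
rewrite /Rintegral (@continuous_FTC2 _ _ (fun x => - w^-1 * cos (w * x)))//.
- by rewrite mulr1 (sin_cos_2pi_int R j).2 !mulr0 cos0 /= subrr.
- apply: continuous_subspaceT => x; apply: continuous_comp;
    last exact: continuous_sin.
  exact: mulrl_continuous.
- split.
  + by move=> x _; case: (dF x).
  + exact/cvg_at_right_filter/cF.
  + exact/cvg_at_left_filter/cF.
- by move=> x _; rewrite derive1E; case: (dF x).
Qed.

(** * Complex exponentials, the modulus, and measurability *)

Definition expi (R : realType) (x : R) : R[i] := Complex (cos x) (sin x).

Lemma expiD (R : realType) (x y : R) : expi (x + y) = expi x * expi y.
Proof.
rewrite /expi cosD sinD; apply/eqP; rewrite eq_complex/=.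
by apply/andP; split; apply/eqP; ring.
Qed.

Lemma conjc_expi (R : realType) (x : R) : conjc (expi x) = expi (- x).
Proof. by rewrite /expi /= cosN sinN. Qed.

Lemma conjcM (R : realType) (z w : R[i]) : conjc (z * w) = conjc z * conjc w.
Proof. exact: rmorphM. Qed.

Lemma normc_expi (R : realType) (x : R) : Normc.normc (expi x) = 1.
Proof. by rewrite /= cos2Dsin2 sqrtr1. Qed.

Lemma sqr_normcE (R : realType) (z : R[i]) :
  Normc.normc z ^+ 2 = complex.Re z ^+ 2 + complex.Im z ^+ 2.
Proof. by case: z => a b /=; rewrite sqr_sqrtr// addr_ge0// sqr_ge0. Qed.

Lemma normc_ge0 (R : realType) (z : R[i]) : 0 <= Normc.normc z.
Proof. by case: z => a b /=; exact: sqrtr_ge0. Qed.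

Lemma ler_Re_normc (R : realType) (z : R[i]) : `|complex.Re z| <= Normc.normc z.
Proof.
rewrite -(ler_pXn2r (n := 2))// ?nnegrE ?normc_ge0// sqr_normcE.
by rewrite real_normK ?num_real// lerDl sqr_ge0.
Qed.

Lemma ler_Im_normc (R : realType) (z : R[i]) : `|complex.Im z| <= Normc.normc z.
Proof.
rewrite -(ler_pXn2r (n := 2))// ?nnegrE ?normc_ge0// sqr_normcE.
by rewrite real_normK ?num_real// lerDr sqr_ge0.
Qed.

Lemma normc_conjc (R : realType) (z : R[i]) :
  Normc.normc (conjc z) = Normc.normc z.
Proof. by case: z => a b /=; rewrite sqrrN. Qed.

Lemma Re_sum (R : realType) (I : Type) (s : seq I) (F : I -> R[i]) :
  complex.Re (\sum_(i <- s) F i) = \sum_(i <- s) complex.Re (F i).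
Proof.
elim: s => [|i s IH]; first by rewrite !big_nil.
by rewrite !big_cons -IH; case: (F i) (\sum_(j <- s) F j) => [a b] [].
Qed.

(** Expands |z|^2 = Re (z conj z) into real terms, so that the square of a trigonometric polynomial
    can be integrated term by term. *)
Lemma sqr_normc_sum (R : realType) (I : Type) (s : seq I) (F : I -> R[i]) :
  Normc.normc (\sum_(i <- s) F i) ^+ 2 =
  \sum_(i <- s) \sum_(j <- s) complex.Re (F i * conjc (F j)).
Proof.
rewrite sqr_normcE (_ : _ + _ =
    complex.Re ((\sum_(i <- s) F i) * conjc (\sum_(i <- s) F i))).
  rewrite rmorph_sum mulr_suml Re_sum; apply: eq_bigr => i _.
  by rewrite mulr_sumr Re_sum.
by case: (\sum_(i <- s) F i) => a b /=; ring.
Qed.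

Lemma measurable_normc (R : realType) (f : R -> R[i]) :
  cmeasurable f -> measurable_fun [set: R] (fun x => Normc.normc (f x)).
Proof.
move=> [mRe mIm].
rewrite (_ : (fun x => _) = fun x =>
    Num.sqrt (complex.Re (f x) ^+ 2 + complex.Im (f x) ^+ 2)); last first.
  by apply/funext => x; case: (f x).
apply: (measurableT_comp (f := @Num.sqrt R)).
  exact: continuous_measurable_fun (@sqrt_continuous R).
by apply: measurable_funD; exact: measurable_funX.
Qed.

Lemma cmeasurableM (R : realType) (f g : R -> R[i]) :
  cmeasurable f -> cmeasurable g -> cmeasurable (fun x => f x * g x).
Proof.
move=> [mRf mIf] [mRg mIg]; split.
- rewrite (_ : (fun x => _) = fun x => complex.Re (f x) * complex.Re (g x)
      - complex.Im (f x) * complex.Im (g x)).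
    by apply: measurable_funB; exact: measurable_funM.
  by apply/funext => x; case: (f x) (g x) => [a b] [].
- rewrite (_ : (fun x => _) = fun x => complex.Re (f x) * complex.Im (g x)
      + complex.Im (f x) * complex.Re (g x)).
    by apply: measurable_funD; exact: measurable_funM.
  by apply/funext => x; case: (f x) (g x) => [a b] [].
Qed.

Lemma cmeasurable_conjc (R : realType) (f : R -> R[i]) :
  cmeasurable f -> cmeasurable (fun x => conjc (f x)).
Proof.
move=> [mR mI]; split.
  rewrite (_ : (fun x => _) = fun x => complex.Re (f x))//.
  by apply/funext => x; case: (f x).
rewrite (_ : (fun x => _) = fun x => - complex.Im (f x)).
  exact: measurableT_comp.
by apply/funext => x; case: (f x).
Qed.

Lemma cmeasurable_sum (R : realType) (I : Type) (s : seq I)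
    (F : I -> R -> R[i]) :
  (forall i, cmeasurable (F i)) -> cmeasurable (fun x => \sum_(i <- s) F i x).
Proof.
move=> mF; elim: s => [|i s [mR mI]].
  by under eq_fun do rewrite big_nil; split; exact: measurable_cst.
under eq_fun do rewrite big_cons; have [mRi mIi] := mF i; split.
- rewrite (_ : (fun x => _) = fun x => complex.Re (F i x)
    + complex.Re (\sum_(j <- s) F j x)); first exact: measurable_funD.
  by apply/funext => x; case: (F i x) (\sum_(j <- s) F j x) => [a b] [].
- rewrite (_ : (fun x => _) = fun x => complex.Im (F i x)
    + complex.Im (\sum_(j <- s) F j x)); first exact: measurable_funD.
  by apply/funext => x; case: (F i x) (\sum_(j <- s) F j x) => [a b] [].
Qed.

Lemma cmeasurable_cst (R : realType) (c : R[i]) : cmeasurable (fun _ : R => c).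
Proof. by split; exact: measurable_cst. Qed.

Lemma cmeasurable_expi (R : realType) (w : R) :
  cmeasurable (fun x : R => expi (w * x)).
Proof.
split => /=; apply: continuous_measurable_fun => x; apply: continuous_comp;
  [exact: mulrl_continuous|exact: continuous_cos
  |exact: mulrl_continuous|exact: continuous_sin].
Qed.

Lemma cmeasurable_translation (R : realType) (a : R) (f : R -> R[i]) :
  cmeasurable f -> cmeasurable (translation a f).
Proof.
move=> [mR mI]; split.
- by apply: (measurableT_comp mR); exact: measurable_funB.
- by apply: (measurableT_comp mI); exact: measurable_funB.
Qed.

(** * Orthonormality of the exponentials on the unit interval *)

(** The integrand is the real part of (a + i b) e^{2 pi i j x}, the form of each term in the
    expanded square of a trigonometric polynomial. *)
Lemma integrable_trig (R : realType) (j : int) (a b : R) :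
  (@lebesgue_measure R).-integrable `[0, 1]
    (fun x => (a * cos (2 * pi * j%:~R * x) - b * sin (2 * pi * j%:~R * x))%:E).
Proof.
apply: continuous_compact_integrable; first exact: segment_compact.
apply: continuous_subspaceT => x.
have mc : {for x, continuous (fun x => 2 * pi * j%:~R * x : R)}.
  exact: mulrl_continuous.
apply: cvgB; apply: cvgM; try exact: cvg_cst.
- by apply: continuous_comp => //; exact: continuous_cos.
- by apply: continuous_comp => //; exact: continuous_sin.
Qed.

Lemma integral_trig (R : realType) (j : int) (a b : R) :
  (\int[@lebesgue_measure R]_(x in `[0%R, 1%R])
    (a * cos (2 * pi * j%:~R * x) - b * sin (2 * pi * j%:~R * x))%:E
   = (a * (j == 0)%:R)%:E)%E.
Proof.
have ic : (@lebesgue_measure R).-integrable `[0, 1]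
    (EFin \o (fun x => cos (2 * pi * j%:~R * x))).
  apply: eq_integrable (integrable_trig j 1 0) => // x _ /=.
  by congr EFin; ring.
have is_ : (@lebesgue_measure R).-integrable `[0, 1]
    (EFin \o (fun x => sin (2 * pi * j%:~R * x))).
  apply: eq_integrable (integrable_trig j 0 (-1)) => // x _ /=.
  by congr EFin; ring.
rewrite -[LHS]fineK; last exact: integrable_fin_num (integrable_trig j a b).
congr EFin; rewrite -/(Rintegral _ _ _).
rewrite RintegralB//; last 2 first.
- exact: (integrableZl _ a ic).
- exact: (integrableZl _ b is_).
rewrite RintegralZl// RintegralZl// Rintegral_cos_2pi_int Rintegral_sin_2pi_int.
by rewrite mulr0 subr0.
Qed.

(** Parseval: in the expanded square the (m, l) term integrates to 0 unless m = l, and distinctness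
    of the indices leaves one diagonal term for each m. *)
Lemma integral_sqr_normc_trig_poly (R : realType) (s : seq int)
    (c : int -> R[i]) :
  uniq s ->
  (\int[@lebesgue_measure R]_(x in `[0%R, 1%R[)
     (Normc.normc (\sum_(m <- s) c m * expi (2 * pi * m%:~R * x)) ^+ 2)%:E
   = (\sum_(m <- s) Normc.normc (c m) ^+ 2)%:E)%E.
Proof.
(* Tiling calls for [0, 1[ and the trigonometric integrals are over [0, 1]; the endpoint is null. *)
move=> us; rewrite integral_itv_bndo_bndc; last first.
  apply: measurable_funTS; apply/measurable_EFinP; apply: measurable_funX.
  apply: measurable_normc; apply: cmeasurable_sum => m.
  by apply: cmeasurableM; [exact: cmeasurable_cst|exact: cmeasurable_expi].
pose d m l := c m * conjc (c l).
transitivity (\int[@lebesgue_measure R]_(x in `[0%R, 1%R])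
   (\sum_(m <- s) \sum_(l <- s)
     (complex.Re (d m l) * cos (2 * pi * (m - l)%:~R * x)
      - complex.Im (d m l) * sin (2 * pi * (m - l)%:~R * x))%:E))%E.
  apply: eq_integral => x _; rewrite sqr_normc_sum -sumEFin.
  apply: eq_bigr => m _.
  rewrite -sumEFin; apply: eq_bigr => l _; congr EFin.
  rewrite conjcM mulrACA conjc_expi -expiD -/(d m l).
  rewrite intrD intrN mulrBr mulrBl.
  by case: (d m l).
rewrite integral_sum//; last first.
  by move=> m; apply: integrable_sum => // l _; exact: integrable_trig.
rewrite -sumEFin; apply: eq_big_seq => m ms.
rewrite integral_sum//; last by move=> l; exact: integrable_trig.
under eq_bigr do rewrite integral_trig.
rewrite sumEFin; congr EFin.
rewrite (bigD1_seq m)//= subrr eqxx mulr1 big1 ?addr0 => [|l lm].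
  by rewrite sqr_normcE /d; case: (c m) => u v /=; ring.
by rewrite subr_eq0 eq_sym (negbTE lm) mulr0.
Qed.

(** * Consequences of a bounded periodization *)

(** Folding the integral onto [0, 1[ replaces [u] by its periodization, which is at most [B] almost
    everywhere. *)
Lemma le_integral_mul_periodic (R : realType) (u p : R -> R) (B : R) :
  measurable_fun [set: R] u -> measurable_fun [set: R] p ->
  (forall x, 0 <= u x) -> (forall x, 0 <= p x) ->
  (forall x (k : int), p (x - k%:~R) = p x) ->
  0 <= B -> ae_summable_le u B ->
  (\int[@lebesgue_measure R]_x (u x * p x)%:E <=
   B%:E * \int[@lebesgue_measure R]_(x in `[0%R, 1%R[) (p x)%:E)%E.
Proof.
move=> mu mp u0 p0 pper B0 uB; rewrite ge0_integral_periodization//.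
have mS : measurable_fun [set: R]
    (fun x => \esum_(k in [set: int]) (u (x - k%:~R))%:E)%E.
  apply: measurable_esum => [k|k x]; last by rewrite lee_fin.
  apply/measurable_EFinP; apply: (measurableT_comp mu).
  exact: measurable_funB.
have S0 x : (0 <= \esum_(k in [set: int]) (u (x - k%:~R))%:E)%E.
  by apply: esum_ge0 => k _; rewrite lee_fin.
rewrite -ge0_integralZl_EFin//; last 2 first.
- by move=> x _; rewrite lee_fin.
- by apply: measurable_funTS; exact/measurable_EFinP.
apply: ae_ge0_le_integral => //.
- by move=> x _; rewrite mule_ge0// lee_fin.
- apply: measurable_funTS; apply: emeasurable_funM => //.
  exact/measurable_EFinP.
- by move=> x _; rewrite mule_ge0// lee_fin.
- apply: measurable_funTS; apply/measurable_EFinP.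
  by apply: measurable_funM => //; exact: measurable_cst.
- have aeF := ae_filter_ringOfSetsType (@lebesgue_measure R).
  by apply: filterS uB => x uB _; rewrite muleC lee_wpmul2r// lee_fin.
Qed.

(** Almost everywhere |f| <= B, hence |f|^2 <= B |f|, and the integral of |f| is at most [B] by
    folding. *)
Lemma ae_summable_le_L2 (R : realType) (f : R -> R[i]) (B : R) :
  0 <= B -> cmeasurable f -> ae_summable_le (fun x => Normc.normc (f x)) B ->
  L2 f.
Proof.
move=> B0 mf fB; split => //.
have mn := measurable_normc mf.
apply: (@le_lt_trans _ _
  (\int[@lebesgue_measure R]_x (Normc.normc (f x) * B)%:E)%E).
  apply: ae_ge0_le_integral => //.
  - by move=> x _; rewrite lee_fin sqr_ge0.
  - by apply/measurable_EFinP; exact: measurable_funX.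
  - by move=> x _; rewrite lee_fin mulr_ge0// normc_ge0.
  - by apply/measurable_EFinP; apply: measurable_funM.
  have aeF := ae_filter_ringOfSetsType (@lebesgue_measure R).
  apply: filterS fB => x fB _; rewrite lee_fin expr2 ler_wpM2l ?normc_ge0//.
  rewrite -lee_fin; apply: le_trans fB; apply: esum_ge.
  (* The modulus at x is the k = 0 term of the periodization. *)
  exists [set 0%R]; first by split.
  by rewrite fsbig_set1 subr0.
(* The periodic factor is here the constant [B], which yields B^2 as a bound. *)
apply: le_lt_trans (le_integral_mul_periodic mn _ _ _ _ B0 fB) _ => //.
- by move=> x; exact: normc_ge0.
- rewrite integral_cst//= lebesgue_measure_itv/= lte_fin ltr01 oppr0 adde0.
  by rewrite -!EFinM ltry.
Qed.

(** * Inner products and Bessel's inequality for the exponentials *)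

(** The product |h| |f| is dominated by |h|^2 + |f|^2. *)
Lemma L2_integrable_mul (R : realType) (h f : R -> R[i]) :
  L2 h -> L2 f ->
  (@lebesgue_measure R).-integrable setT
    (fun x => (Normc.normc (h x) * Normc.normc (f x))%:E).
Proof.
move=> [mh h2] [mf f2].
have mnh := measurable_normc mh; have mnf := measurable_normc mf.
have i2 (u : R -> R[i]) : cmeasurable u -> (L2_sqnorm u < +oo)%E ->
    (@lebesgue_measure R).-integrable setT
      (fun x => (Normc.normc (u x) ^+ 2)%:E).
  move=> mu u2; apply/integrableP; split.
    by apply/measurable_EFinP; apply: measurable_funX; exact: measurable_normc.
  apply: le_lt_trans u2; rewrite le_eqVlt; apply/orP; left; apply/eqP.
  by apply: eq_integral => x _; rewrite gee0_abs// lee_fin sqr_ge0.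
apply: le_integrable (integrableD _ (i2 h mh h2) (i2 f mf f2)) => //.
  by apply/measurable_EFinP; exact: measurable_funM.
move=> x _; rewrite -EFinD !abse_EFin lee_fin.
rewrite !ger0_norm ?mulr_ge0 ?normc_ge0// ?addr_ge0 ?sqr_ge0//.
have := sqr_ge0 (Normc.normc (h x) - Normc.normc (f x)).
have := mulr_ge0 (normc_ge0 (h x)) (normc_ge0 (f x)).
rewrite sqrrB; lra.
Qed.

Lemma L2_inner_integrable (R : realType) (h f : R -> R[i]) : L2 h -> L2 f ->
  (@lebesgue_measure R).-integrable setT
    (EFin \o (fun x => complex.Re (h x * conjc (f x)))) /\
  (@lebesgue_measure R).-integrable setT
    (EFin \o (fun x => complex.Im (h x * conjc (f x)))).
Proof.
move=> hL fL; have hf := L2_integrable_mul hL fL.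
have [mR mI] := cmeasurableM hL.1 (cmeasurable_conjc fL.1).
have nE x : `|Normc.normc (h x) * Normc.normc (f x)| =
    Normc.normc (h x * conjc (f x)).
  by rewrite Normc.normcM normc_conjc ger0_norm// mulr_ge0// normc_ge0.
split; apply: le_integrable hf => //.
- exact/measurable_EFinP.
- by move=> x _; rewrite /= lee_fin nE; exact: ler_Re_normc.
- exact/measurable_EFinP.
- by move=> x _; rewrite /= lee_fin nE; exact: ler_Im_normc.
Qed.

(** Complex linearity of the integral in real-part form; when c is [cintegral w] itself, the value
    is |c|^2. *)
Lemma integral_Re_conjM (R : realType) (c : R[i]) (w : R -> R[i]) :
  (@lebesgue_measure R).-integrable setT
    (EFin \o (fun x => complex.Re (w x))) ->
  (@lebesgue_measure R).-integrable setT
    (EFin \o (fun x => complex.Im (w x))) ->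
  (@lebesgue_measure R).-integrable setT
    (fun x => (complex.Re (conjc c * w x))%:E) /\
  (\int[@lebesgue_measure R]_x (complex.Re (conjc c * w x))%:E =
   (complex.Re (conjc c * cintegral w))%:E)%E.
Proof.
move=> iR iI.
have E z : complex.Re (conjc c * z) =
    complex.Re c * complex.Re z + complex.Im c * complex.Im z.
  by case: c z => [a b] [u v] /=; ring.
have iRc : (@lebesgue_measure R).-integrable setT
    (EFin \o (fun x => complex.Re c * complex.Re (w x))).
  exact: (integrableZl _ _ iR).
have iIc : (@lebesgue_measure R).-integrable setT
    (EFin \o (fun x => complex.Im c * complex.Im (w x))).
  exact: (integrableZl _ _ iI).
have iE : (@lebesgue_measure R).-integrable setT
    (fun x => (complex.Re (conjc c * w x))%:E).
  by apply: eq_integrable (integrableD _ iRc iIc) => // x _; rewrite E EFinD.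
split => //; rewrite -[LHS]fineK; last exact: integrable_fin_num iE.
congr EFin; rewrite -/(Rintegral _ _ _).
under eq_Rintegral do rewrite E.
by rewrite RintegralD// !RintegralZl// E.
Qed.

(* With c_m = <h, e_m f> and P = sum c_m e_m, the left-hand side S equals
   Re <h, f P>, and AM-GM bounds the integrand by
   (B |h|^2 |f| + |f| |P|^2 / B) / 2; periodizing |f| and using orthonormality,
   the second term contributes at most S / 2, which is absorbed. *)
Lemma bessel_exponentials (R : realType) (h f : R -> R[i]) (B : R)
    (s : seq int) :
  0 < B -> L2 h -> cmeasurable f ->
  ae_summable_le (fun x => Normc.normc (f x)) B -> uniq s ->
  ((\sum_(m <- s)
     Normc.normc (L2_inner h (fun x => expi (2 * pi * m%:~R * x) * f x)) ^+ 2)%:E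
   <= B%:E * \int[@lebesgue_measure R]_x
        (Normc.normc (h x) ^+ 2 * Normc.normc (f x))%:E)%E.
Proof.
move=> B0 hL mf fB us.
pose e (m : int) (x : R) := expi (2 * pi * m%:~R * x) * f x.
have normce m x : Normc.normc (e m x) = Normc.normc (f x).
  by rewrite Normc.normcM normc_expi mul1r.
have eL m : L2 (e m).
  apply: (@ae_summable_le_L2 _ _ B) => //; first exact: ltW.
    by apply: cmeasurableM => //; exact: cmeasurable_expi.
  rewrite (_ : (fun x => _) = fun x => Normc.normc (f x))//.
  exact/funext.
pose c m := L2_inner h (e m).
rewrite -/(e _); under eq_bigr do rewrite -/(c _).
pose P x := \sum_(m <- s) c m * expi (2 * pi * m%:~R * x).
pose S := \sum_(m <- s) Normc.normc (c m) ^+ 2.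
rewrite -/S.
pose w m x := h x * conjc (e m x).
have cw m := let i := L2_inner_integrable hL (eL m) in
  @integral_Re_conjM R (c m) (w m) i.1 i.2.
(* [G] is the real part of h conj(f P), written as a sum so that it integrates term by term to
   [S]. *)
pose G x := \sum_(m <- s) complex.Re (conjc (c m) * w m x).
have iG : (@lebesgue_measure R).-integrable setT (fun x => (G x)%:E).
  rewrite (_ : (fun x => _) =
      fun x => (\sum_(m <- s) (complex.Re (conjc (c m) * w m x))%:E)%E).
    by apply: integrable_sum => // m _; exact: (cw m).1.
  by apply/funext => x; rewrite sumEFin.
have GS : (\int[@lebesgue_measure R]_x (G x)%:E = S%:E)%E.
  under eq_integral do rewrite /G -sumEFin.
  rewrite integral_sum//; last by move=> m; exact: (cw m).1.
  rewrite -sumEFin; apply: eq_bigr => m _; rewrite (cw m).2; congr EFin.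
  by rewrite -[cintegral _]/(c m) sqr_normcE; case: (c m) => u v /=; ring.
have GP x : `|G x| <= Normc.normc (h x) * Normc.normc (f x) * Normc.normc (P x).
  rewrite /G -Re_sum (_ : \sum_(m <- s) _ = h x * conjc (f x * P x)).
    apply: le_trans (ler_Re_normc _) _.
    by rewrite Normc.normcM normc_conjc Normc.normcM mulrA.
  rewrite /P mulr_sumr rmorph_sum mulr_sumr; apply: eq_bigr => m _.
  by rewrite /w /e !conjcM; ring.
have mnh := measurable_normc hL.1; have mnf := measurable_normc mf.
have mnP : measurable_fun [set: R] (fun x => Normc.normc (P x)).
  apply: measurable_normc; apply: cmeasurable_sum => m.
  by apply: cmeasurableM; [exact: cmeasurable_cst|exact: cmeasurable_expi].
pose u x := Normc.normc (h x) ^+ 2 * Normc.normc (f x).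
pose v x := Normc.normc (f x) * Normc.normc (P x) ^+ 2.
have u0 x : 0 <= u x by rewrite mulr_ge0 ?sqr_ge0 ?normc_ge0.
have v0 x : 0 <= v x by rewrite mulr_ge0 ?sqr_ge0 ?normc_ge0.
have mu : measurable_fun [set: R] u.
  by apply: measurable_funM => //; exact: measurable_funX.
have mv : measurable_fun [set: R] v.
  by apply: measurable_funM => //; exact: measurable_funX.
have vS : (\int[@lebesgue_measure R]_x (v x)%:E <= (B * S)%:E)%E.
  rewrite EFinM -(integral_sqr_normc_trig_poly c us).
  apply: le_integral_mul_periodic => //; last exact: ltW.
  - exact: measurable_funX.
  - by move=> x; exact: normc_ge0.
  - by move=> x; exact: sqr_ge0.
  - move=> x k; congr (Normc.normc _ ^+ 2); apply: eq_bigr => m _.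
    congr (_ * _).
    have [s0 c1] := sin_cos_2pi_int R (m * - k).
    rewrite mulrBr expiD (_ : - _ = 2 * pi * (m * - k)%:~R).
      by rewrite /expi s0 c1 -[Complex 1 0]/(1 : R[i]) mulr1.
    by rewrite intrM intrN; ring.
have b20 : 0 <= B / 2 by lra.
have b2V0 : 0 <= (2 * B)^-1 by rewrite invr_ge0; lra.
have Sle : (S%:E <= (B / 2)%:E * \int[@lebesgue_measure R]_x (u x)%:E
    + (2^-1 * S)%:E)%E.
  apply: (@le_trans _ _ (\int[@lebesgue_measure R]_x
      ((B / 2)%:E * (u x)%:E + (2 * B)^-1%:E * (v x)%:E))%E).
    have S0 : 0 <= S by apply: sumr_ge0 => m _; exact: sqr_ge0.
    rewrite (_ : S%:E = `|S%:E|%E); last by rewrite gee0_abs.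
    rewrite -GS; apply: le_trans (le_abse_integral _ _ _) _ => //.
      exact: measurable_int iG.
    apply: ge0_le_integral => //.
    - by apply: measurableT_comp => //; exact: measurable_int iG.
    - apply: emeasurable_funD; apply: measurable_funeM;
        exact/measurable_EFinP.
    - move=> x _; rewrite -!EFinM -EFinD abse_EFin lee_fin.
      apply: le_trans (GP x) _; rewrite /u /v.
      have := normc_ge0 (f x).
      set a := Normc.normc (h x); set d := Normc.normc (f x).
      set p := Normc.normc (P x) => d0.
      (* The weights B / 2 and 1 / (2 B) complete the square, and the second turns the bound B S on
         the integral of [v] into S / 2. *)
      rewrite -subr_ge0 (_ : _ - _ = (2 * B)^-1 * (d * (B * a - p) ^+ 2)).
        by rewrite mulr_ge0// mulr_ge0// sqr_ge0.
      by field; rewrite gt_eqF.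
  rewrite ge0_integralD//; first last.
  - by apply: measurable_funeM; exact/measurable_EFinP.
  - by move=> x _; rewrite -EFinM lee_fin mulr_ge0.
  - by apply: measurable_funeM; exact/measurable_EFinP.
  - by move=> x _; rewrite -EFinM lee_fin mulr_ge0.
  rewrite ge0_integralZl_EFin//;
    [|by move=> x _; rewrite lee_fin|exact/measurable_EFinP].
  rewrite ge0_integralZl_EFin//;
    [|by move=> x _; rewrite lee_fin|exact/measurable_EFinP].
  rewrite leeD2l// (_ : 2^-1 * S = (2 * B)^-1 * (B * S));
    last by field; rewrite gt_eqF.
  by rewrite EFinM lee_wpmul2l.
have : (0 <= \int[@lebesgue_measure R]_x (u x)%:E)%E.
  by apply: integral_ge0 => x _; rewrite lee_fin.
move: Sle; rewrite -[X in _ -> _ -> (_ <= _ * X)%E]/(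
  \int[@lebesgue_measure R]_x (u x)%:E)%E.
(* For a finite value r, S <= (B / 2) r + S / 2 rearranges to S <= B r; for +oo the right-hand side
   is +oo since B > 0, and -oo is excluded by nonnegativity. *)
case: (\int[@lebesgue_measure R]_x (u x)%:E)%E => [r| |//].
- by rewrite -!EFinM -EFinD !lee_fin; lra.
- by move=> _ _; rewrite gt0_muley ?lte_fin// leey.
Qed.

(** * Summation over the half-integer translates, and conclusion *)

Lemma bessel_system_gabor_half_one (R : realType) (f : R -> R[i]) (B : R) :
  0 < B -> cmeasurable f -> ae_summable_le (fun x => Normc.normc (f x)) B ->
  bessel_system (gabor_system f (1 / 2) 1).
Proof.
move=> B0 mf fB; have B0' := ltW B0.
pose T (n : int) := translation (n%:~R * (1 / 2)) f.
have mT n : cmeasurable (T n) by exact: cmeasurable_translation.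
have TB n : ae_summable_le (fun x => Normc.normc (T n x)) B.
  have := ae_translation (n%:~R * (1 / 2)) fB.
  have aeF := ae_filter_ringOfSetsType (@lebesgue_measure R).
  apply: filterS => x; apply: le_trans; apply: le_esum => k _.
  by rewrite /T /translation addrAC.
have gaborE m n : gabor_system f (1 / 2) 1 (m, n) =
    fun x => expi (2 * pi * m%:~R * x) * T n x.
  by apply/funext => x; rewrite /gabor_system /modulation/= mulr1.
split=> [[m n]|].
  rewrite gaborE; apply: (@ae_summable_le_L2 _ _ B) => //.
    by apply: cmeasurableM => //; exact: cmeasurable_expi.
  rewrite (_ : (fun x => _) = fun x => Normc.normc (T n x))//.
  by apply/funext => x; rewrite Normc.normcM normc_expi mul1r.
(* One factor [B] comes from Bessel's inequality at fixed n, the factor [B + B] from summing |T n|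
   over n. *)
exists (B * (B + B)) => h hL.
have mnh := measurable_normc hL.1.
have mnT n := measurable_normc (mT n).
have muT n : measurable_fun [set: R]
    (fun x => (Normc.normc (h x) ^+ 2 * Normc.normc (T n x))%:E).
  apply/measurable_EFinP; apply: measurable_funM => //.
  exact: measurable_funX.
have hT0 n x : (0 <= (Normc.normc (h x) ^+ 2 * Normc.normc (T n x))%:E)%E.
  by rewrite lee_fin mulr_ge0 ?sqr_ge0 ?normc_ge0.
pose F (n m : int) : \bar R :=
  (Normc.normc (L2_inner h (fun x => expi (2 * pi * m%:~R * x) * T n x)) ^+ 2)%:E.
have F0 n m : (0 <= F n m)%E by rewrite lee_fin sqr_ge0.
(* The indices are swapped so that the inner sum runs over the modulations m of a fixed translate
   n. *)
rewrite (reindex_esum setT setT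
  (fun nm : int * int => (nm.2, nm.1)))/=; last first.
  by split=> // [[n m] [n' m'] _ _ [-> ->]|[m n] _]//; exists (n, m).
rewrite (_ : [set: int * int] = setT `*`` (fun=> setT)); last first.
  by apply/seteqP; split.
rewrite (eq_esum (b := fun nm => F nm.1 nm.2)); last first.
  by move=> [n m] _; rewrite gaborE.
rewrite -(esum_esum (a := F))//.
apply: (@le_trans _ _ (\esum_(n in [set: int])
  (B%:E * \int[@lebesgue_measure R]_x
    (Normc.normc (h x) ^+ 2 * Normc.normc (T n x))%:E))%E).
  (* The sum over m is a supremum over finite index sets, so the inequality for finite sums
     suffices. *)
  apply: le_esum => n _; apply: ge_ereal_sup => _ [X [finX _] <-].
  rewrite fsbig_finite//= /F sumEFin.
  by apply: bessel_exponentials => //; exact: finmap.fset_uniq.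
rewrite ge0_esumZl//; last by move=> n; exact: integral_ge0.
rewrite EFinM -muleA lee_wpmul2l ?lee_fin//.
(* Tonelli brings the sum over n under the integral, where it can be bounded pointwise. *)
rewrite -(@ge0_integral_esum _ _ _ (@lebesgue_measure R) _
  (fun n x => (Normc.normc (h x) ^+ 2 * Normc.normc (T n x))%:E))//.
have mn2 : measurable_fun [set: R] (fun x => (Normc.normc (h x) ^+ 2)%:E).
  by apply/measurable_EFinP; exact: measurable_funX.
rewrite /L2_sqnorm -ge0_integralZl_EFin//; last 2 first.
- by move=> x _; rewrite lee_fin sqr_ge0.
- lra.
apply: ae_ge0_le_integral => //.
- by move=> x _; exact: esum_ge0.
- exact: measurable_esum.
- by move=> x _; rewrite -EFinM lee_fin mulr_ge0 ?sqr_ge0//; lra.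
- exact: measurable_funeM.
have aeF := ae_filter_ringOfSetsType (@lebesgue_measure R).
have := ae_esum_half_shifts (fun x => normc_ge0 (f x)) fB.
apply: filterS => x fx _.
under eq_esum do rewrite EFinM.
rewrite ge0_esumZl ?sqr_ge0//; last by move=> n; rewrite lee_fin normc_ge0.
by rewrite muleC lee_wpmul2r// lee_fin sqr_ge0.
Qed.

Theorem theorem4p7 (R : realType) (f g : R -> R[i])
    (hf : Linf1l2 f) (hg : Linf1l2 g) :
  bessel_system (gabor_system (fun x : R => f x * g x) (1 / 2) 1).
Proof.
have [B B0 fgB] := Linf1l2_mul_bound hf hg.
apply: (bessel_system_gabor_half_one B0) => //.
exact: cmeasurableM hf.1 hg.1.
Qed.
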